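(* Let $(X,\mathcal A)$ be a measurable space, and let $k_1,k_2$ be bounded measurable kernels on $X$ with reproducing kernel Hilbert spaces $H_1$ and $H_2$. Let $H$ be the reproducing kernel Hilbert space of the kernel $k=k_1+k_2$. Then for all $\mu\in\mathcal M(X)$ we have $$\|\mu\|_H^2=\|\mu\|_{H_1}^2+\|\mu\|_{H_2}^2.$$ In particular, if $k_1$ is characteristic, then $k$ is characteristic, and if $k_1$ has an injective kernel embedding on $\mathcal M(X)$, then so does $k$.
   Context: A kernel on $X$ is a symmetric positive definite function $k:X\times X\to\mathbb R$ (i.e. $\sum_{i,j}a_ia_jk(x_i,x_j)\ge0$ for all finite choices). $\mathcal M(X)$ is the space of finite signed measures on $(X,\mathcal A)$ and $\mathcal M_1(X)$ the set of probability measures. For a bounded measurable kernel $k$ with RKHS $H$, the kernel embedding is $\Phi:\mathcal M(X)\to H$, $\Phi(\mu):=\int_X k(\cdot,x)\,\mathrm d\mu(x)$ (Pettis integral), and $\|\mu\|_H:=\|\Phi(\mu)\|_H$. A bounded measurable kernel is called characteristic if the restriction of its kernel embedding to $\mathcal M_1(X)$ is injective. *)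

(* Defs.v *)
From HB Require Import structures.
From mathcomp Require Import all_boot all_order all_algebra.
From mathcomp Require Import all_classical all_reals all_analysis.

Set Implicit Arguments.
Unset Strict Implicit.
Unset Printing Implicit Defensive.

Import Order.TTheory GRing.Theory Num.Theory.
Import numFieldNormedType.Exports.

Local Open Scope classical_set_scope.
Local Open Scope ring_scope.

Definition is_kernel (R : realType) (X : Type) (k : X -> X -> R) : Prop :=
  (forall x y, k x y = k y x) /\
  (forall (n : nat) (a : 'I_n -> R) (x : 'I_n -> X),
     0 <= \sum_(i < n) \sum_(j < n) a i * a j * k (x i) (x j)).

Definition kernel_bounded (R : realType) (X : Type) (k : X -> X -> R) : Prop :=
  exists M : R, forall x y, `|k x y| <= M.

(* Joint measurability, for the product sigma-algebra on X * X. *)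
Definition kernel_measurable (R : realType) (d : measure_display)
    (X : measurableType d) (k : X -> X -> R) : Prop :=
  measurable_fun [set: X * X] (fun p : X * X => k p.1 p.2).

(* A Hilbert space of functions on X is represented by a complete normed space
   whose norm comes from an inner product, together with an injective linear
   map [rkhs_fun] sending a vector to the function X -> R that it is.
   [rkhs_sec H x] is the vector whose function is k(., x). *)
Record rkhs (R : realType) (X : Type) (k : X -> X -> R) := Rkhs {
  rkhs_space :> completeNormedModType R;
  rkhs_dot : {dot rkhs_space for idfun};
  rkhs_dot_norm : forall f : rkhs_space, rkhs_dot f f = `|f| ^+ 2;
  rkhs_fun : {linear rkhs_space -> (X -> R)};
  rkhs_fun_inj : injective rkhs_fun;
  rkhs_sec : X -> rkhs_space;
  rkhs_secE : forall x y : X, rkhs_fun (rkhs_sec x) y = k y x;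
  rkhs_reproducing : forall (f : rkhs_space) (x : X),
    rkhs_fun f x = rkhs_dot f (rkhs_sec x)
}.

Section charge_integral.
Context (R : realType) (d : measure_display) (X : measurableType d).
Variable mu : {charge set X -> \bar R}.

Definition hahn_pos : set X := sval (cid (Hahn_decomposition mu)).

Definition hahn_neg : set X := sval (cid (svalP (cid (Hahn_decomposition mu)))).

Definition hahn_posneg : hahn_decomposition mu hahn_pos hahn_neg :=
  svalP (cid (svalP (cid (Hahn_decomposition mu)))).

Definition charge_integrable (D : set X) (f : X -> R) : Prop :=
  (charge_variation hahn_posneg).-integrable D (EFin \o f).

(* The Jordan parts, hence the value, do not depend on the Hahn decomposition
   chosen above. *)
Definition charge_integral (D : set X) (f : X -> R) : R :=
  \int[jordan_pos hahn_posneg]_(x in D) f x -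
  \int[jordan_neg hahn_posneg]_(x in D) f x.

End charge_integral.

Section pettis.
Context (R : realType) (d : measure_display) (X : measurableType d).
Variables (V : normedModType R) (mu : {charge set X -> \bar R}) (F : X -> V).

Definition is_pettis_integral (D : set X) (g : V) : Prop :=
  forall phi : {linear V -> R^o}, continuous phi ->
    charge_integrable mu D (phi \o F) /\
    phi g = charge_integral mu D (phi \o F).

Definition pettis_integrable : Prop :=
  forall D : set X, measurable D -> exists g : V, is_pettis_integral D g.

(* The conventional value 0 is used when F is not Pettis integrable. *)
Definition pettis_integral : V :=
  xget 0 [set g | pettis_integrable /\ is_pettis_integral setT g].

End pettis.

Section embedding.
Context (R : realType) (d : measure_display) (X : measurableType d).
Variables (k : X -> X -> R) (H : rkhs k).

Definition kernel_embedding (mu : {charge set X -> \bar R}) : H :=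
  pettis_integral mu (@rkhs_sec R X k H).

Definition embedding_norm (mu : {charge set X -> \bar R}) : R :=
  `|kernel_embedding mu|.

(* Equality of charges is tested on measurable sets only, since library
   charges are functions on all subsets of X. *)
Definition injective_embedding : Prop :=
  forall mu nu : {charge set X -> \bar R},
    kernel_embedding mu = kernel_embedding nu ->
    forall A : set X, measurable A -> mu A = nu A.

Definition characteristic : Prop :=
  forall P Q : probability X R,
    kernel_embedding (charge_of_finite_measure P) =
    kernel_embedding (charge_of_finite_measure Q) ->
    forall A : set X, measurable A -> P A = Q A.

End embedding.

(* Main.v *)
(* The Riesz theorem turns f |-> int f dmu into a vector Phi(mu) of H with
   <Phi(mu), f> = int f dmu for every f in H; testing against k(., y) gives
   Phi(mu)(y) = int k(x, y) dmu(x). Hence Phi(mu) = Phi1(mu) + Phi2(mu) as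
   functions on X, and integrating against nu,
   <Phi(mu), Phi(nu)> = <Phi1(mu), Phi1(nu)> + <Phi2(mu), Phi2(nu)>.
   Expanding squares, |Phi(mu) - Phi(nu)|^2 splits in the same way, so that
   Phi(mu) = Phi(nu) forces Phi1(mu) = Phi1(nu). *)
Require Import Defs.
From HB Require Import structures.
From mathcomp Require Import all_boot all_order all_algebra.
From mathcomp Require Import all_classical all_reals all_analysis.
From mathcomp Require Import measurable_realfun ring lra.

Set Implicit Arguments.
Unset Strict Implicit.
Unset Printing Implicit Defensive.

Import Order.TTheory GRing.Theory Num.Theory.
Import numFieldNormedType.Exports.

Local Open Scope classical_set_scope.
Local Open Scope ring_scope.

(** * Hilbert space geometry: Cauchy-Schwarz, projection, Riesz representation *)

Section inner_product.
Context (R : realType) (V : completeNormedModType R) (dot : {dot V for idfun}).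
Hypothesis dot_norm : forall v : V, dot v v = `|v| ^+ 2.

Lemma dotC (u v : V) : dot u v = dot v u.
Proof. by rewrite (@hermitian_subproof _ _ _ _ dot) expr0 mul1r. Qed.

Lemma dotDr (u v w : V) : dot u (v + w) = dot u v + dot u w.
Proof. by rewrite linearDr. Qed.

Lemma dotZr a (u v : V) : dot u (a *: v) = a * dot u v.
Proof. by rewrite linearZr_LR. Qed.

Lemma dot0r (u : V) : dot u 0 = 0.
Proof. by rewrite linear0r. Qed.

Lemma dotDl (u v w : V) : dot (u + v) w = dot u w + dot v w.
Proof. by rewrite dotC dotDr !(dotC w). Qed.

Lemma dotZl a (u v : V) : dot (a *: u) v = a * dot u v.
Proof. by rewrite dotC dotZr dotC. Qed.

Lemma dotBl (u v w : V) : dot (u - v) w = dot u w - dot v w.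
Proof. by rewrite -scaleN1r dotDl dotZl mulN1r. Qed.

Lemma dotBr (u v w : V) : dot u (v - w) = dot u v - dot u w.
Proof. by rewrite dotC dotBl !(dotC u). Qed.

Lemma norm_dotB (u v : V) :
  `|u - v| ^+ 2 = `|u| ^+ 2 - 2 * dot u v + `|v| ^+ 2.
Proof.
by rewrite -!dot_norm dotBl !dotBr (dotC v u); ring.
Qed.

Lemma norm_dotD (u v : V) :
  `|u + v| ^+ 2 = `|u| ^+ 2 + 2 * dot u v + `|v| ^+ 2.
Proof.
by rewrite -!dot_norm dotDl !dotDr (dotC v u); ring.
Qed.

(** The square of the norm of |v|^2 u - <u, v> v expands to |v|^2 (|u|^2 |v|^2 - <u, v>^2), and the
    factor |v|^2 cancels once v is nonzero. *)
Lemma dot_cauchy_schwarz (u v : V) : `|dot u v| <= `|u| * `|v|.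
Proof.
have [->|v0] := eqVneq v 0.
  by rewrite dot0r !normr0 mulr0.
have v2 : 0 < `|v| ^+ 2 by rewrite exprn_gt0// normr_gt0.
rewrite -(@ler_pXn2r _ 2)// ?nnegrE ?mulr_ge0// real_normK ?num_real// exprMn.
have := sqr_ge0 `| (`|v| ^+ 2) *: u - dot u v *: v|.
rewrite norm_dotB !normrZ !exprMn dotZr dotZl !real_normK ?num_real//.
move=> h; rewrite -(ler_pM2r v2) -subr_ge0; apply: le_trans h _.
by rewrite le_eqVlt; apply/orP; left; apply/eqP; ring.
Qed.

Section projection.
Variable S : set V.
Hypothesis closedS : closed S.
Hypothesis S0 : S 0.
Hypothesis SD : forall u v, S u -> S v -> S (u + v).
Hypothesis SZ : forall a u, S u -> S (a *: u).

(** With d = <x - s, t>, moving s by (d / |t|^2) t stays in [S] and lowers the squared distance to x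
    by d^2 / |t|^2; minimality forces d = 0. *)
Lemma minimal_residual_orthogonal (x s : V) : S s ->
  (forall t, S t -> `|x - s| ^+ 2 <= `|x - t| ^+ 2) ->
  forall t, S t -> dot (x - s) t = 0.
Proof.
move=> Ss min_s t St.
have [->|t0] := eqVneq t 0; first by rewrite dot0r.
set d := dot _ _.
have t2 : 0 < `|t| ^+ 2 by rewrite exprn_gt0// normr_gt0.
have := min_s _ (SD Ss (SZ (d / `|t| ^+ 2) St)).
rewrite opprD addrA (norm_dotB (x - s)) dotZr -/d normrZ exprMn.
rewrite real_normK ?num_real// => h.
have {h} : d ^+ 2 / `|t| ^+ 2 <= 0.
  rewrite -subr_ge0 in h; rewrite -oppr_ge0; apply: le_trans h _.
  by rewrite le_eqVlt; apply/orP; left; apply/eqP; field; rewrite normr_eq0.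
rewrite pmulr_lle0 ?invr_gt0// => d2.
by apply/eqP; rewrite -sqrf_eq0 eq_le d2 sqr_ge0.
Qed.

(* A minimising sequence is Cauchy by the parallelogram identity. *)
Lemma projection (x : V) :
  exists2 s, S s & forall t, S t -> dot (x - s) t = 0.
Proof.
pose E : set R := [set `|x - s| ^+ 2 | s in S].
have infE : has_inf E.
  by split; [exists (`|x - 0| ^+ 2), 0|exists 0 => _ [s _ <-]; exact: sqr_ge0].
have inf_le t : S t -> inf E <= `|x - t| ^+ 2.
  by move=> St; apply: ge_inf; [exact: infE.2|exists t].
have seq_ex n : exists s, S s /\ `|x - s| ^+ 2 < inf E + n.+1%:R^-1.
  have e0 : 0 < n.+1%:R^-1 :> R by rewrite invr_gt0.
  have [_ [s Ss <-] ?] := inf_adherent e0 infE.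
  by exists s.
pose s_ n := sval (cid (seq_ex n)).
have s_S n : S (s_ n) by exact: (svalP (cid (seq_ex n))).1.
have s_inf n : `|x - s_ n| ^+ 2 < inf E + n.+1%:R^-1.
  exact: (svalP (cid (seq_ex n))).2.
have s_dist m n : `|s_ m - s_ n| ^+ 2 <= 2 * m.+1%:R^-1 + 2 * n.+1%:R^-1.
  (* The midpoint lies in [S], so the sum of the two residuals has squared norm at least 4 [inf E];
     each residual alone has squared norm below [inf E] plus its own 1/(n+1). *)
  have mid : S (2^-1 *: (s_ m + s_ n)) by exact/SZ/SD.
  have := inf_le _ mid.
  have -> : x - 2^-1 *: (s_ m + s_ n) = 2^-1 *: ((x - s_ m) + (x - s_ n)).
    rewrite addrACA -opprD scalerBr; congr (_ - _).
    by rewrite -mulr2n -(scaler_nat 2 x) scalerA mulVf ?scale1r// pnatr_eq0.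
  have -> : s_ m - s_ n = (x - s_ n) - (x - s_ m).
    by rewrite opprB [RHS]addrC addrA subrK.
  rewrite normrZ exprMn (norm_dotD (x - s_ m)) (norm_dotB (x - s_ n)).
  rewrite (dotC (x - s_ n)) real_normK ?num_real//.
  have := s_inf m; have := s_inf n.
  set a := `|x - s_ m| ^+ 2; set b := `|x - s_ n| ^+ 2; set c := dot _ _.
  set im := m.+1%:R^-1; set i_n := n.+1%:R^-1.
  have -> : 2^-1 ^+ 2 = 4^-1 :> R by field.
  move=> *; lra.
have s_cvg : cvgn s_.
  apply: cauchy_cvg; apply: cauchy_exP => e e0.
  (* Norms are compared through their squares: each of the two terms in [s_dist] then falls below
     e^2 / 2. *)
  have e40 : 0 < e ^+ 2 / 4 by rewrite divr_gt0// exprn_gt0.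
  have [N _ small] := near_infty_natSinv_lt (PosNum e40).
  exists (s_ N); exists N => // n /= Nn; rewrite -ball_normE/=.
  rewrite -(@ltr_pXn2r _ 2)// ?nnegrE ?normr_ge0 ?ltW//.
  apply: le_lt_trans (s_dist _ _) _.
  have := small _ Nn; have /= := small _ (leqnn N).
  set im := N.+1%:R^-1; set i_n := n.+1%:R^-1; move=> *; lra.
have S_lim : S (limn s_).
  apply: (@closed_cvg _ _ _ _ s_ S closedS _ _ s_cvg).
  exact: nearW.
exists (limn s_) => //; apply: minimal_residual_orthogonal => //.
move=> t St; apply: le_trans (inf_le _ St).
(* Passing to the limit in [s_inf] shows that the limit attains the infimum. *)
have cvgL : `|x - s_ n| ^+ 2 @[n --> \oo] --> `|x - limn s_| ^+ 2.
  rewrite expr2; under eq_fun do rewrite expr2.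
  by apply: cvgM; apply: cvg_norm; apply: cvgB => //; exact: cvg_cst.
have cvgU : inf E + n.+1%:R^-1 @[n --> \oo] --> inf E.
  rewrite -[X in _ --> X]addr0; apply: cvgD; first exact: cvg_cst.
  exact: cvg_harmonic.
rewrite -(cvg_lim (@Rhausdorff R) cvgL) -(cvg_lim (@Rhausdorff R) cvgU).
apply: ler_lim; [exact: cvgP cvgL|exact: cvgP cvgU|].
by apply: nearW => n; exact/ltW.
Qed.

End projection.

(** Let e be the residual of projecting onto the closed kernel of [phi] a vector outside it. For
    each h, phi(e) h - phi(h) e is in the kernel, hence orthogonal to e, which gives phi(h) |e|^2 =
    phi(e) <e, h>. *)
Lemma riesz (phi : {linear V -> R^o}) : continuous phi ->
  exists g, forall h, phi h = dot g h.
Proof.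
move=> phi_cont; have [phi0|/existsNP[x phix]] := pselect (forall h, phi h = 0).
  by exists 0 => h; rewrite phi0 dotC dot0r.
pose S := [set h | phi h = 0].
have closedS : closed S.
  apply: (@preimage_closed _ _ phi [set 0]); last exact: closed_eq.
  by move=> h _; exact: phi_cont.
have [] := @projection S closedS _ _ _ x.
- exact: linear0.
- by rewrite /S => u v /= pu pv; rewrite linearD pu pv addr0.
- by rewrite /S => a u /= pu; rewrite linearZ/= pu scaler0.
move=> s phis; set e := x - s => e_orth.
have phie : phi e = phi x by rewrite linearB/= phis subr0.
have e0 : `|e| ^+ 2 != 0.
  rewrite expf_neq0// normr_eq0; apply/eqP => e0; apply: phix.
  by rewrite -phie e0 linear0.
exists ((phi e / `|e| ^+ 2) *: e) => h; rewrite dotZl.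
have /e_orth : S (phi e *: h - phi h *: e).
  by rewrite /S/= linearB !linearZ/= /GRing.scale/= mulrN mulrC subrr.
rewrite dotBr !dotZr dot_norm => /eqP; rewrite subr_eq0 => /eqP eq_h.
by rewrite mulrAC eq_h mulfK.
Qed.

(** The codomain [R^o] makes these functionals eligible as test functionals in
    [is_pettis_integral]. *)
Definition dotl (g : V) : V -> R^o := dot g.

Lemma dotl_is_linear g : linear (dotl g).
Proof. by move=> a u v; rewrite /dotl dotDr dotZr. Qed.

HB.instance Definition _ g :=
  GRing.isLinear.Build R V R^o _ (dotl g) (dotl_is_linear g).

Lemma continuous_dotl g : continuous (dotl g).
Proof.
apply/linear_bounded_continuous/bounded_funP => r.
exists (`|g| * r) => v vr; apply: le_trans (dot_cauchy_schwarz _ _) _.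
by rewrite ler_wpM2l.
Qed.

End inner_product.

(** * Integration of bounded measurable functions against a signed measure *)

Section charge_integral_theory.
Context (R : realType) (d : measure_display) (X : measurableType d).
Variable mu : {charge set X -> \bar R}.
Implicit Types (D : set X) (f g : X -> R).

(** For such integrands integrability is automatic, because the Jordan parts and the variation of a
    charge are finite measures. *)
Definition bounded_measurable f : Prop :=
  measurable_fun setT f /\ exists C, forall x, `|f x| <= C.

Lemma bounded_measurable_integrable (m : {measure set X -> \bar R}) D f :
  measurable D -> (m D < +oo)%E -> bounded_measurable f ->
  m.-integrable D (EFin \o f).
Proof.
move=> mD mDoo [mf [C fC]]; apply: measurable_bounded_integrable => //.
  exact: measurable_funS mf.
exists C; split; first exact: num_real.
by move=> M CM x _; exact: le_trans (fC x) (ltW CM).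
Qed.

Lemma jordan_pos_integrable D f : measurable D -> bounded_measurable f ->
  (jordan_pos (hahn_posneg mu)).-integrable D (EFin \o f).
Proof.
move=> mD; apply: bounded_measurable_integrable => //.
by rewrite -ge0_fin_numE// fin_num_measure.
Qed.

Lemma jordan_neg_integrable D f : measurable D -> bounded_measurable f ->
  (jordan_neg (hahn_posneg mu)).-integrable D (EFin \o f).
Proof.
move=> mD; apply: bounded_measurable_integrable => //.
by rewrite -ge0_fin_numE// fin_num_measure.
Qed.

Lemma bounded_charge_integrable D f : measurable D -> bounded_measurable f ->
  charge_integrable mu D f.
Proof.
move=> mD; apply: bounded_measurable_integrable => //.
by rewrite ltey_eq fin_num_measure.
Qed.

Lemma charge_integralD D f g : measurable D ->
  bounded_measurable f -> bounded_measurable g ->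
  charge_integral mu D (fun x => f x + g x) =
  charge_integral mu D f + charge_integral mu D g.
Proof.
move=> mD bf bg; rewrite /charge_integral.
rewrite !RintegralD//; first (by rewrite opprD addrACA);
  by [exact: jordan_pos_integrable|exact: jordan_neg_integrable].
Qed.

Lemma charge_integralZ D a f : measurable D -> bounded_measurable f ->
  charge_integral mu D (fun x => a * f x) = a * charge_integral mu D f.
Proof.
move=> mD bf; rewrite /charge_integral !RintegralZl// ?mulrBr//;
  by [exact: jordan_pos_integrable|exact: jordan_neg_integrable].
Qed.

(** The factor of C is the total variation of [mu] on [D]. The bound makes integration a continuous
    functional on the RKHS. *)
Lemma norm_charge_integral_le D f C : measurable D -> measurable_fun setT f ->
  (forall x, `|f x| <= C) ->
  `|charge_integral mu D f| <=
  C * (fine (jordan_pos (hahn_posneg mu) D) +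
       fine (jordan_neg (hahn_posneg mu) D)).
Proof.
move=> mD mf fC; have bf : bounded_measurable f by split => //; exists C.
have bC : bounded_measurable (cst C) by split=> //; exists `|C|.
have bN : bounded_measurable (fun x => `|f x|).
  split; first exact: measurableT_comp.
  by exists C => x; rewrite normr_id.
rewrite /charge_integral mulrDr -!Rintegral_cst//.
apply: le_trans (ler_normB _ _) _; apply: lerD.
  apply: le_trans (le_normr_Rintegral mD (jordan_pos_integrable mD bf)) _.
  by apply: le_Rintegral => //; exact: jordan_pos_integrable.
apply: le_trans (le_normr_Rintegral mD (jordan_neg_integrable mD bf)) _.
by apply: le_Rintegral => //; exact: jordan_neg_integrable.
Qed.

End charge_integral_theory.

(** * The kernel embedding into a single RKHS *)

Section embedding_theory.
Context (R : realType) (d : measure_display) (X : measurableType d).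
Variables (k : X -> X -> R) (H : rkhs k).
Hypothesis bk : kernel_bounded k.
Hypothesis mk : kernel_measurable k.
Implicit Type mu : {charge set X -> \bar R}.

Let dot := rkhs_dot H.
Let dotE := @rkhs_dot_norm _ _ _ H.

Lemma rkhs_sec_bounded : exists C, forall x, `|rkhs_sec H x| <= C.
Proof.
have [M kM] := bk; exists (M + 1) => x.
have : `|rkhs_sec H x| ^+ 2 <= M.
  rewrite -rkhs_dot_norm -rkhs_reproducing rkhs_secE.
  exact: le_trans (ler_norm _) (kM x x).
(* Square roots are avoided: (s - 1)^2 >= 0 and s^2 <= M give 2 s <= M + 1, and s >= 0. *)
have := sqr_ge0 (`|rkhs_sec H x| - 1); have := normr_ge0 (rkhs_sec H x).
by set s := `|_|; nra.
Qed.

(** Cauchy-Schwarz against the sections bounds all evaluations uniformly, so norm convergence in [H]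
    implies uniform convergence on [X]. *)
Lemma norm_rkhs_fun_le : exists C, forall (f : H) x,
  `|rkhs_fun H f x| <= `|f| * C.
Proof.
have [C secC] := rkhs_sec_bounded; exists C => f x.
rewrite rkhs_reproducing; apply: le_trans (dot_cauchy_schwarz dotE _ _) _.
by rewrite ler_wpM2l.
Qed.

(* The f with measurable function form a closed subspace containing every
   k(., x), and a vector orthogonal to all k(., x) vanishes. *)
Lemma measurable_rkhs_fun (f : H) : measurable_fun setT (rkhs_fun H f).
Proof.
pose S := [set h : H | measurable_fun setT (rkhs_fun H h)].
have [C funC] := norm_rkhs_fun_le.
have closedS : closed S.
  move=> h clSh.
  have approx n : exists g, S g /\ `|h - g| < n.+1%:R^-1.
    have n0 : 0 < n.+1%:R^-1 :> R by rewrite invr_gt0.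
    have [g [Sg]] := clSh _ (nbhsx_ballx h _ n0).
    by rewrite -ball_normE; exists g.
  pose g_ n := sval (cid (approx n)).
  have g_S n : S (g_ n) := (svalP (cid (approx n))).1.
  have g_h n : `|h - g_ n| < n.+1%:R^-1 := (svalP (cid (approx n))).2.
  apply: (@measurable_fun_cvg _ _ _ _ (fun n => rkhs_fun H (g_ n))) => //.
  move=> x _; apply/cvgrPdist_le => e e0.
  (* The sign of [C] is unknown ([X] may be empty), so a positive majorant replaces it before
     dividing. *)
  have C0 : 0 < `|C| + 1 by rewrite ltr_wpDl.
  have eC0 : 0 < e / (`|C| + 1) by rewrite divr_gt0.
  have [N _ small] := near_infty_natSinv_lt (PosNum eC0).
  exists N => // n /= Nn.
  have -> : rkhs_fun H h x - rkhs_fun H (g_ n) x = rkhs_fun H (h - g_ n) x.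
    by rewrite linearB.
  apply: le_trans (funC _ _) _.
  apply: (@le_trans _ _ (`|h - g_ n| * (`|C| + 1))).
    by rewrite ler_wpM2l// (le_trans (ler_norm _))// lerDl.
  rewrite -ler_pdivlMr//; apply: ltW; apply: lt_trans (g_h n) _.
  exact: (small _ Nn).
have S0 : S 0 by rewrite /S/= linear0; exact: measurable_cst.
have SD u v : S u -> S v -> S (u + v).
  by rewrite /S/= => m_u m_v; rewrite linearD; exact: measurable_funD.
have SZ a u : S u -> S (a *: u).
  by rewrite /S/= => m_u; rewrite linearZ; exact: measurable_funM.
have [s Ss orth] := projection dotE closedS S0 SD SZ f.
suff -> : f = s by [].
apply/eqP; rewrite -subr_eq0; apply/eqP; apply: (@rkhs_fun_inj _ _ _ H).
rewrite linear0; apply/funext => x; rewrite rkhs_reproducing.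
apply: orth; rewrite /S/=.
rewrite (_ : rkhs_fun H _ = (fun p => k p.1 p.2) \o (fun y => (y, x))).
  by apply: measurableT_comp => //; exact: pair2_measurable.
by apply/funext => y; rewrite rkhs_secE.
Qed.

Lemma bounded_measurable_rkhs_fun (f : H) : bounded_measurable (rkhs_fun H f).
Proof.
split; first exact: measurable_rkhs_fun.
by have [C funC] := norm_rkhs_fun_le; exists (`|f| * C).
Qed.

Definition integral_functional mu (D : set X) : H -> R^o :=
  fun f => charge_integral mu D (rkhs_fun H f).

Lemma integral_functional_is_linear mu D : measurable D ->
  linear (integral_functional mu D).
Proof.
move=> mD a u v; rewrite /integral_functional.
rewrite (_ : rkhs_fun H _ = fun x => a * rkhs_fun H u x + rkhs_fun H v x).
  rewrite charge_integralD ?charge_integralZ//.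
  - exact: bounded_measurable_rkhs_fun.
  - split; first exact: measurable_funM (measurable_rkhs_fun u).
    have [_ [C uC]] := bounded_measurable_rkhs_fun u.
    by exists (`|a| * C) => x; rewrite normrM ler_wpM2l.
  - exact: bounded_measurable_rkhs_fun.
by rewrite linearP.
Qed.

(** Riesz applies since |f(x)| <= |f| C bounds the integral by |f| times a constant. All measurable
    [D] are treated because Pettis integrability asks for a vector on each of them. *)
Lemma integral_functional_representative mu D : measurable D ->
  exists g : H, forall h, charge_integral mu D (rkhs_fun H h) = dot g h.
Proof.
move=> mD; pose lin := GRing.isLinear.Build R H R^o _ _
  (integral_functional_is_linear mu mD).
pose L : {linear H -> R^o} := HB.pack (integral_functional mu D) lin.
apply: (riesz dotE (phi := L)).
apply/linear_bounded_continuous/bounded_funP => r.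
have [C funC] := norm_rkhs_fun_le.
pose T := fine (jordan_pos (hahn_posneg mu) D) +
       fine (jordan_neg (hahn_posneg mu) D).
exists (r * `|C| * T) => h hr.
apply: norm_charge_integral_le => //; first exact: measurable_rkhs_fun.
move=> x; apply: le_trans (funC _ _) _.
apply: (@le_trans _ _ (`|h| * `|C|)); first by rewrite ler_wpM2l// ler_norm.
by rewrite ler_wpM2r.
Qed.

(** By Riesz every continuous test functional is <h, .> for some h, and by the reproducing property
    its composition with the sections is the function of h itself. *)
Lemma rkhs_pettisP mu D (g : H) : measurable D ->
  is_pettis_integral mu (@rkhs_sec _ _ _ H) D g <->
  forall h, dot g h = charge_integral mu D (rkhs_fun H h).
Proof.
move=> mD.
have secE (h : H) : dotl dot h \o @rkhs_sec _ _ _ H = rkhs_fun H h.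
  by apply/funext => x /=; rewrite rkhs_reproducing.
split=> [g_int h|g_int phi /(riesz dotE)[h phiE]].
  have [_] := g_int (dotl dot h) (continuous_dotl dotE (g := h)).
  by rewrite secE /dotl dotC.
have -> : phi \o @rkhs_sec _ _ _ H = rkhs_fun H h.
  by rewrite -secE; apply/funext => x /=; rewrite phiE.
split; last by rewrite phiE dotC g_int.
by apply: bounded_charge_integrable => //; exact: bounded_measurable_rkhs_fun.
Qed.

Lemma dot_kernel_embedding mu (h : H) :
  dot (kernel_embedding H mu) h = charge_integral mu setT (rkhs_fun H h).
Proof.
apply: (rkhs_pettisP mu _ measurableT).1.
have pettis_ex D : measurable D ->
    exists g : H, is_pettis_integral mu (@rkhs_sec _ _ _ H) D g.
  move=> mD; have [g gE] := integral_functional_representative mu mD.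
  by exists g; apply/rkhs_pettisP.
(* Since the sections are Pettis integrable, the default value 0 of [pettis_integral] is never taken
   for lack of an integral. *)
rewrite /kernel_embedding /pettis_integral; case: xgetP => [g _ []//|].
by have [g gE] := pettis_ex _ measurableT => /(_ g) [].
Qed.

Lemma kernel_embeddingE mu y : rkhs_fun H (kernel_embedding H mu) y =
  charge_integral mu setT (fun x => k x y).
Proof.
rewrite rkhs_reproducing dot_kernel_embedding; congr charge_integral.
by apply/funext => x; rewrite rkhs_secE.
Qed.

Lemma bounded_measurable_section y : bounded_measurable (fun x => k x y).
Proof.
have := bounded_measurable_rkhs_fun (rkhs_sec H y).
rewrite (_ : rkhs_fun H _ = fun x => k x y)//.
by apply/funext => x; rewrite rkhs_secE.
Qed.

End embedding_theory.

(** * Comparison of the three embeddings for a sum of kernels *)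

Section sum_of_kernels.
Context (R : realType) (d : measure_display) (X : measurableType d).
Variables k1 k2 : X -> X -> R.
Hypotheses (bk1 : kernel_bounded k1) (bk2 : kernel_bounded k2).
Hypotheses (mk1 : kernel_measurable k1) (mk2 : kernel_measurable k2).
Variables (H1 : rkhs k1) (H2 : rkhs k2) (H : rkhs (fun x y => k1 x y + k2 x y)).
Implicit Types mu nu : {charge set X -> \bar R}.

Let bk : kernel_bounded (fun x y => k1 x y + k2 x y).
Proof.
have [[M1 le1] [M2 le2]] := (bk1, bk2); exists (M1 + M2) => x y.
by apply: le_trans (ler_normD _ _) _; exact: lerD.
Qed.

Let mk : kernel_measurable (fun x y => k1 x y + k2 x y).
Proof. exact: measurable_funD. Qed.

Lemma kernel_embedding_sum mu :
  rkhs_fun H (kernel_embedding H mu) =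
  fun x => rkhs_fun H1 (kernel_embedding H1 mu) x +
           rkhs_fun H2 (kernel_embedding H2 mu) x.
Proof.
apply/funext => y; rewrite !kernel_embeddingE// charge_integralD//.
  exact: (bounded_measurable_section H1).
exact: (bounded_measurable_section H2).
Qed.

(** The vectors live in three different spaces and cannot be added; each inner product is therefore
    turned into the integral against [mu] of the function embedding [nu], and functions on [X] do
    add. *)
Lemma dot_kernel_embedding_sum mu nu :
  rkhs_dot H (kernel_embedding H mu) (kernel_embedding H nu) =
  rkhs_dot H1 (kernel_embedding H1 mu) (kernel_embedding H1 nu) +
  rkhs_dot H2 (kernel_embedding H2 mu) (kernel_embedding H2 nu).
Proof.
rewrite !dot_kernel_embedding// kernel_embedding_sum charge_integralD//;
  exact: bounded_measurable_rkhs_fun.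
Qed.

(* Expanding the square avoids the linearity of the embedding in the charge. *)
Lemma dist_kernel_embedding_sum mu nu :
  `|kernel_embedding H mu - kernel_embedding H nu| ^+ 2 =
  `|kernel_embedding H1 mu - kernel_embedding H1 nu| ^+ 2 +
  `|kernel_embedding H2 mu - kernel_embedding H2 nu| ^+ 2.
Proof.
rewrite !(norm_dotB (@rkhs_dot_norm _ _ _ _)) -!rkhs_dot_norm.
by rewrite !dot_kernel_embedding_sum; ring.
Qed.

(** A vanishing sum of two squares has vanishing terms. Both injectivity claims reduce to this, the
    characteristic one through the charges of probability measures. *)
Lemma eq_kernel_embedding_sum mu nu :
  kernel_embedding H mu = kernel_embedding H nu ->
  kernel_embedding H1 mu = kernel_embedding H1 nu.
Proof.
move=> eqH; have := dist_kernel_embedding_sum mu nu.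
rewrite eqH subrr normr0 expr0n/= => /esym/eqP.
rewrite paddr_eq0 ?exprn_ge0// => /andP[+ _].
by rewrite expf_eq0/= normr_eq0 subr_eq0 => /eqP.
Qed.

End sum_of_kernels.

Theorem lemma3p3 (R : realType) (d : measure_display) (X : measurableType d)
    (k1 k2 : X -> X -> R)
    (hk1 : is_kernel k1) (hk2 : is_kernel k2)
    (bk1 : kernel_bounded k1) (bk2 : kernel_bounded k2)
    (mk1 : kernel_measurable k1) (mk2 : kernel_measurable k2)
    (H1 : rkhs k1) (H2 : rkhs k2) (H : rkhs (fun x y => k1 x y + k2 x y)) :
  (forall mu : {charge set X -> \bar R},
     embedding_norm H mu ^+ 2 =
     embedding_norm H1 mu ^+ 2 + embedding_norm H2 mu ^+ 2) /\
  (characteristic H1 -> characteristic H) /\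
  (injective_embedding H1 -> injective_embedding H).
Proof.
split; [|split].
(* The norm identity is the diagonal case of the inner product identity. *)
- move=> mu; rewrite /embedding_norm -!rkhs_dot_norm.
  exact: dot_kernel_embedding_sum.
- by move=> char1 P Q eqPQ; apply: char1; exact: eq_kernel_embedding_sum eqPQ.
- by move=> inj1 mu nu eqH; apply: inj1; exact: eq_kernel_embedding_sum eqH.
Qed.
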